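(* Let $G$ be a fractal group. The set of open, normal, pronilpotent subgroups of $G$ is self-similarity closed: if $H$ is an open normal pronilpotent subgroup of $G$, then so is the self-similar closure of $H$ in $G$.
   Context: Let $T$ be the infinite $d$-regular rooted tree, with path data: a labeling of the vertices at level one by $0,\dots,d-1$ and, for each such vertex $i$, a rooted tree isomorphism $\lambda_i:T_i\to T$, where $T_v$ denotes the subtree over a vertex $v$. For each vertex $v$ there is a unique composition $\lambda_v:T_v\to T$ of the $\lambda_i$'s taking $v$ to the root. For a subgroup $H\le\mathrm{Aut}\,T$, $H_v$ is the stabilizer of $v$ in $H$, $\pi_v(h)=\lambda_v\circ h|_{T_v}\circ\lambda_v^{-1}$ for $h\in H_v$, and $H^v=\pi_v(H_v)$. A closed subgroup $G\le\mathrm{Aut}\,T$ is self-similar if $G^v\subseteq G$ for every vertex $v$, and fractal if $G^v=G$ for every vertex $v$. The self-similar closure of a closed subgroup $H\le G$ is the smallest closed self-similar subgroup of $G$ containing $H$. *)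

(* Defs.v *)
From HB Require Import structures.
From mathcomp Require Import all_boot all_fingroup all_solvable.
From mathcomp Require Import all_classical topology.

Set Implicit Arguments.
Unset Strict Implicit.
Unset Printing Implicit Defensive.

Local Open Scope classical_set_scope.
Local Open Scope group_scope.

(* The infinite d-regular rooted tree: vertices are words over 'I_d, the root
   is the empty word and the children of x are the words rcons x i. *)
Definition vertex (d : nat) := seq 'I_d.

Definition child d (x y : vertex d) : bool := [exists i, y == rcons x i].

Definition subtree d (v : vertex d) : set (vertex d) := [set x | prefix v x].

(* f restricts to an isomorphism of rooted trees from the subtree over u to the
   subtree over v; its values outside the subtree over u are irrelevant. *)
Definition tree_iso d (u v : vertex d) (f : vertex d -> vertex d) : Prop :=
  [/\ set_bij (subtree u) (subtree v) f, f u = v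
    & forall x y, subtree u x -> subtree u y -> child (f x) (f y) = child x y].

Record tree_aut (d : nat) := Aut {
  aut_fun :> vertex d -> vertex d;
  aut_iso : tree_iso [::] [::] aut_fun }.

Lemma aut_ext d (g h : tree_aut d) : (forall x, g x = h x) -> g = h.
Proof.
case: g h => [f Hf] [f' Hf'] /= /funext E; case: _ / E Hf' => Hf'.
by congr Aut; exact: Prop_irrelevance.
Qed.

Lemma tree_iso_id d (v : vertex d) : tree_iso v v id.
Proof. by split=> //; split=> // x vx; exists x. Qed.

Lemma tree_iso_comp d (u v w : vertex d) f g :
  tree_iso u v f -> tree_iso v w g -> tree_iso u w (g \o f).
Proof.
move=> [fb fr fc] [gb gr gc]; split; first exact: (set_bij_comp fb gb).
  by rewrite /= fr gr.
have fS x : subtree u x -> subtree v (f x) by case: fb => fS _ _; exact: fS.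
by move=> x y ux uy; rewrite /= gc ?fc //; exact: fS.
Qed.

Lemma tree_iso_inv d (u v : vertex d) f : tree_iso u v f ->
  exists2 g, tree_iso v u g &
    (forall x, subtree u x -> g (f x) = x) /\
    (forall y, subtree v y -> f (g y) = y).
Proof.
move=> [[fS fI fO] fr fc].
have /choice[g gP] y : exists x, subtree v y -> subtree u x /\ f x = y.
  case: (pselect (subtree v y)) => [vy|nvy]; last by exists [::].
  by have [x ux <-] := fO _ vy; exists x.
have gf x : subtree u x -> g (f x) = x.
  move=> ux; have [uy fy] := gP _ (fS _ ux).
  by apply: fI; rewrite ?inE.
exists g; split=> //.
- split=> [y /gP[]//|x y|x ux]; last by exists (f x); [exact: fS|exact: gf].
  by rewrite !inE => /gP[_ {2}<-] /gP[_ {2}<-] ->.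
- by rewrite -fr gf //; exact: prefix_refl.
- by move=> x y /gP[ux fx] /gP[uy fy]; rewrite -fc // fx fy.
- by move=> y /gP[].
Qed.

Lemma tree_iso_cat d (u v x : vertex d) f s : tree_iso u v f -> subtree u x ->
  exists2 t, f (x ++ s) = f x ++ t & size t = size s.
Proof.
move=> [_ _ fc] ux; elim/last_ind: s => [|s i [t ft ts]].
  by exists [::]; rewrite ?cats0.
have us r : subtree u (x ++ r) by apply: prefix_trans ux (prefix_prefix _ _).
have : child (x ++ s) (x ++ rcons s i).
  by apply/existsP; exists i; rewrite -rcons_cat.
rewrite -fc // => /existsP[k /eqP ->].
by exists (rcons t k); rewrite ?ft ?rcons_cat // !size_rcons ts.
Qed.

Lemma tree_iso_sub d (u v x : vertex d) f :
  tree_iso u v f -> subtree u x -> tree_iso x (f x) f.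
Proof.
move=> fi ux; have [g gi [fK gK]] := tree_iso_inv fi.
have xu y : subtree x y -> subtree u y by move=> xy; apply: prefix_trans ux xy.
case: (fi) => -[fS fI _] _ fc; have vfx := fS _ ux.
have vfxP y : subtree (f x) y -> subtree v y.
  by move=> xy; apply: prefix_trans vfx xy.
split=> [|//|y z /xu uy /xu uz]; last exact: fc.
split=> [y xy|y z|y fxy].
- case/prefixP: (xy) => s ->; have [t -> _] := tree_iso_cat s fi ux.
  exact: prefix_prefix.
- by rewrite !inE => /xu uy /xu uz; apply: fI; rewrite inE.
- exists (g y); last exact/gK/vfxP.
  case/prefixP: (fxy) => s ->; have [t -> _] := tree_iso_cat s gi vfx.
  by rewrite fK //; exact: prefix_prefix.
Qed.

Lemma subtree_root d (x : vertex d) : subtree [::] x.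
Proof. exact: prefix0s. Qed.

Definition aut1 d : tree_aut d := Aut (@tree_iso_id d [::]).

Definition aut_mul d (g h : tree_aut d) : tree_aut d :=
  Aut (tree_iso_comp (aut_iso h) (aut_iso g)).

Definition aut_inv d (g : tree_aut d) : tree_aut d :=
  let w := cid2 (tree_iso_inv (aut_iso g)) in Aut (s2valP w).

Lemma aut_invK d (g : tree_aut d) x : aut_inv g (g x) = x.
Proof. by rewrite /aut_inv; case: cid2 => f /= _ [+ _]; apply; exact: prefix0s. Qed.

Lemma autK_inv d (g : tree_aut d) x : g (aut_inv g x) = x.
Proof. by rewrite /aut_inv; case: cid2 => f /= _ [_]; apply; exact: prefix0s. Qed.

HB.instance Definition _ d := gen_eqMixin (tree_aut d).
HB.instance Definition _ d := gen_choiceMixin (tree_aut d).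

Fact aut_mulA d : associative (@aut_mul d).
Proof. by move=> f g h; exact: aut_ext. Qed.
Fact aut_mul1g d : left_id (@aut1 d) (@aut_mul d).
Proof. by move=> f; exact: aut_ext. Qed.
Fact aut_mulg1 d : right_id (@aut1 d) (@aut_mul d).
Proof. by move=> f; exact: aut_ext. Qed.
Fact aut_mulVg d : left_inverse (@aut1 d) (@aut_inv d) (@aut_mul d).
Proof. by move=> f; apply: aut_ext => x; exact: aut_invK. Qed.
Fact aut_mulgV d : right_inverse (@aut1 d) (@aut_inv d) (@aut_mul d).
Proof. by move=> f; apply: aut_ext => x; exact: autK_inv. Qed.

HB.instance Definition _ d :=
  isGroup.Build (tree_aut d) (@aut_mulA d) (@aut_mul1g d) (@aut_mulg1 d)
    (@aut_mulVg d) (@aut_mulgV d).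

(* The profinite topology of Aut T: a basis of neighbourhoods of g is given by
   the sets of automorphisms that agree with g on the first n levels. *)
Definition level_ball d (g : tree_aut d) (n : nat) : set (tree_aut d) :=
  [set h | forall x : vertex d, (size x <= n)%N -> h x = g x].

Definition aut_nbhs d (g : tree_aut d) : set_system (tree_aut d) :=
  [set A | exists n, level_ball g n `<=` A].

HB.instance Definition _ d := hasNbhs.Build (tree_aut d) (@aut_nbhs d).

Fact aut_nbhs_filter d (g : tree_aut d) : ProperFilter (nbhs g).
Proof.
apply: Build_ProperFilter_ex.
  by move=> A [n nA]; exists g; apply: nA.
split; first by exists 0%N.
- move=> A B [n nA] [m mB]; exists (maxn n m) => h hP.
  by split; [apply: nA|apply: mB] => x xn; apply: hP;
    rewrite (leq_trans xn) // ?leq_maxl ?leq_maxr.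
- by move=> A B AB [n nA]; exists n => h /nA /AB.
Qed.

Fact aut_nbhs_singleton d (g : tree_aut d) (A : set (tree_aut d)) : nbhs g A -> A g.
Proof. by move=> [n]; apply. Qed.

Fact aut_nbhs_nbhs d (g : tree_aut d) (A : set (tree_aut d)) :
  nbhs g A -> nbhs g (nbhs^~ A).
Proof.
move=> [n nA]; exists n => h hg; exists n => k kh.
by apply: nA => x xn; rewrite kh // hg.
Qed.

HB.instance Definition _ d := Nbhs_isNbhsTopological.Build (tree_aut d)
  (@aut_nbhs_filter d) (@aut_nbhs_singleton d) (@aut_nbhs_nbhs d).

Definition subgroup d (H : set (tree_aut d)) : Prop :=
  [/\ H 1, forall g h, H g -> H h -> H (g * h) & forall g, H g -> H g^-1].

Definition closed_subgroup d (H : set (tree_aut d)) : Prop := subgroup H /\ closed H.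

Definition normal_in d (G N : set (tree_aut d)) : Prop :=
  [/\ subgroup N, N `<=` G & forall g n, G g -> N n -> N (n ^ g)].

Definition open_in d (G A : set (tree_aut d)) : Prop :=
  exists2 U : set (tree_aut d), open U & A = G `&` U.

(* Inverse systems of finite nilpotent groups over a nonempty directed preorder;
   is_map i j is meaningful only when is_le i j holds. *)
Record nil_inverse_system := NilInverseSystem {
  is_index : Type;
  is_le : is_index -> is_index -> Prop;
  is_le_refl : forall i, is_le i i;
  is_le_trans : forall i j k, is_le i j -> is_le j k -> is_le i k;
  is_nonempty : exists i : is_index, True;
  is_directed : forall i j, exists2 k, is_le i k & is_le j k;
  is_obj : is_index -> finGroupType;
  is_nilpotent : forall i, nilpotent [set: is_obj i]%SET;
  is_map : forall i j, is_obj j -> is_obj i;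
  is_map_morph : forall i j, is_le i j -> {morph @is_map i j : x y / x * y};
  is_map_id : forall i x, @is_map i i x = x;
  is_map_comp : forall i j k, is_le i j -> is_le j k ->
    forall x, @is_map i j (@is_map j k x) = @is_map i k x }.

(* The maps p i, restricted to H, are continuous homomorphisms to the (discrete)
   groups of S which identify H, as a topological group, with the inverse limit
   of S: they are compatible with the transition maps, they give a bijection from
   H to the set of compatible families, and the fibres of the p i form a basis of
   the topology of H. *)
Definition is_inverse_limit d (H : set (tree_aut d)) (S : nil_inverse_system)
    (p : forall i : is_index S, tree_aut d -> is_obj i) : Prop :=
  [/\ forall i g h, H g -> H h -> p i (g * h) = p i g * p i h,
      forall i j g, is_le i j -> H g -> is_map i (p j g) = p i g,
      forall x : forall i, is_obj i,
        (forall i j, is_le i j -> is_map i (x j) = x i) ->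
        exists! h, H h /\ forall i, p i h = x i,
      forall i (x : is_obj i), open_in H [set h | H h /\ p i h = x]
    & forall (U : set (tree_aut d)) g, open_in H U -> U g ->
        exists i, forall h, H h -> p i h = p i g -> U h].

Definition pronilpotent d (H : set (tree_aut d)) : Prop :=
  exists S : nil_inverse_system, exists p, @is_inverse_limit d H S p.

(* The level-one vertex [:: j] carries the label pd_label j, and pd_map i is the
   isomorphism from the subtree over the level-one vertex with label i to T. *)
Record path_data (d : nat) := PathData {
  pd_label : 'I_d -> 'I_d;
  pd_label_bij : bijective pd_label;
  pd_map : 'I_d -> vertex d -> vertex d;
  pd_map_iso : forall j, tree_iso [:: j] [::] (pd_map (pd_label j)) }.

(* The composition of the pd_map's taking v to the root: if v lies over the
   level-one vertex with label i, first apply pd_map i, then recursively the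
   composition for the vertex pd_map i v, whose level is one less. *)
Fixpoint vmap_rec d (P : path_data d) (n : nat) (v : vertex d) :
    vertex d -> vertex d :=
  match n, v with
  | n'.+1, j :: _ => let f := pd_map P (pd_label P j) in vmap_rec P n' (f v) \o f
  | _, _ => id
  end.

Definition vmap d (P : path_data d) (v : vertex d) : vertex d -> vertex d :=
  vmap_rec P (size v) v.

(* g is the conjugate vmap P v o h o (vmap P v)^-1 of the restriction of h to the
   subtree over v. *)
Definition vproj d (P : path_data d) (v : vertex d) (h g : tree_aut d) : Prop :=
  forall x, subtree v x -> g (vmap P v x) = vmap P v (h x).

Lemma vmap_rec_iso d (P : path_data d) (n : nat) (v : vertex d) :
  size v = n -> tree_iso v [::] (vmap_rec P n v).
Proof.
elim: n v => [v /size0nil ->|n IHn [//|j w] [wn] /=]; first exact: tree_iso_id.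
have jv : subtree [:: j] (j :: w) by exact: (prefix_prefix [:: j]).
have /tree_iso_sub /(_ jv) := pd_map_iso P j.
move: (pd_map _ _) (pd_map_iso P j) => f fi fv.
apply: tree_iso_comp fv (IHn _ _).
have [s -> ss] := tree_iso_cat w fi (prefix_refl [:: j]).
by case: fi => _ -> _; rewrite ss.
Qed.

Lemma vmap_iso d (P : path_data d) (v : vertex d) : tree_iso v [::] (vmap P v).
Proof. exact: vmap_rec_iso. Qed.

Lemma vproj_ex d (P : path_data d) (v : vertex d) (h : tree_aut d) :
  h v = v -> exists! g, vproj P v h g.
Proof.
move=> hv; have := tree_iso_sub (aut_iso h) (subtree_root v); rewrite hv => hi.
have [f fi [fK Kf]] := tree_iso_inv (vmap_iso P v).
exists (Aut (tree_iso_comp (tree_iso_comp fi hi) (vmap_iso P v))); split.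
  by move=> x vx; rewrite /= fK.
move=> g gP; apply: aut_ext => y /=.
have vfy : subtree v (f y).
  by case: fi => -[fS _ _] _ _; apply: fS; exact: subtree_root.
by rewrite -gP // Kf //; exact: subtree_root.
Qed.

Definition stabilizer d (H : set (tree_aut d)) (v : vertex d) : set (tree_aut d) :=
  [set h | H h /\ h v = v].

Definition vsection d (P : path_data d) (H : set (tree_aut d)) (v : vertex d) :
    set (tree_aut d) :=
  [set g | exists2 h, stabilizer H v h & vproj P v h g].

Definition self_similar d (P : path_data d) (G : set (tree_aut d)) : Prop :=
  closed_subgroup G /\ forall v, vsection P G v `<=` G.

Definition fractal d (P : path_data d) (G : set (tree_aut d)) : Prop :=
  closed_subgroup G /\ forall v, vsection P G v = G.

Definition self_similar_closure d (P : path_data d) (G H : set (tree_aut d)) :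
    set (tree_aut d) :=
  smallest [set K | self_similar P K /\ K `<=` G] H.

Lemma self_similar_closureP d (P : path_data d) (G H : set (tree_aut d)) :
  self_similar P G -> H `<=` G ->
  let K := self_similar_closure P G H in
  [/\ self_similar P K, H `<=` K, K `<=` G
    & forall L, self_similar P L -> L `<=` G -> H `<=` L -> K `<=` L].
Proof.
move=> sG HG K.
have KL L : self_similar P L -> L `<=` G -> H `<=` L -> K `<=` L.
  by move=> sL LG HL; apply: smallest_sub.
have HK : H `<=` K by exact: sub_gen_smallest.
split=> //; last exact: KL.
split; last first.
  move=> v g [h [Kh hv] gP] L LP; case: (LP) => -[[_ sL] _] _.
  by apply: (sL v); exists h => //; split=> //; exact: Kh.
split; last first.
  by rewrite /K /self_similar_closure /smallest; apply: closed_bigI => L [[[[]]]].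
split=> [L [[[[[]]]]]//|g h Kg Kh L LP|g Kg L LP].
  by have := Kg _ LP; have := Kh _ LP; case: LP => -[[[[_ LM _] _] _] _] _ ? ?;
    exact: LM.
by have := Kg _ LP; case: LP => -[[[[_ _ LV] _] _] _] _; exact: LV.
Qed.

Definition open_normal_pronilpotent d (G H : set (tree_aut d)) : Prop :=
  [/\ open_in G H, normal_in G H & pronilpotent H].

(* Main.v *)
Require Import Defs.
From mathcomp Require Import all_boot all_fingroup all_solvable.
From mathcomp Require Import all_classical topology.

(* A closed subgroup X of Aut T is pronilpotent iff its image on the words of
   length at most n is nilpotent for every n; this passes to the sections X^v
   and, by Fitting's theorem, to products of normal subgroups. Let K be a
   maximal open normal pronilpotent subgroup of G between H and its
   self-similar closure; it exists because H has finite index. As G is fractal,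
   K^v is normal in G, so K K^v is again such a subgroup, whence K^v <= K by
   maximality. Thus K is self-similar and equals the closure. Only K K^v is
   shown to be open and closed, not K^v, so no compactness is needed. *)

Set Implicit Arguments.
Unset Strict Implicit.
Unset Printing Implicit Defensive.

Local Open Scope classical_set_scope.
Local Open Scope group_scope.

(** * Images of subgroups under maps to finite groups *)

Section FiniteImages.
Variables (d : nat) (gT : finGroupType).
Implicit Types (X Y : set (tree_aut d)) (p : tree_aut d -> gT).

(** Multiplicativity is asked on [X] only: projections of an inverse limit and sections at a vertex
    are homomorphisms only on a subgroup. *)
Definition morph_on X p := forall g h, X g -> X h -> p (g * h) = p g * p h.

Definition fin_image p X : {set gT} :=
  [set y | `[< exists2 h, X h & p h = y >]]%SET.

Lemma fin_imageP p X y :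
  reflect (exists2 h, X h & p h = y) (y \in fin_image p X).
Proof. by rewrite inE; exact: asboolP. Qed.

Lemma fin_imageS p X Y : X `<=` Y -> fin_image p X \subset fin_image p Y.
Proof.
move=> XY; apply/fintype.subsetP => y /fin_imageP[h /XY Yh <-].
by apply/fin_imageP; exists h.
Qed.

Lemma morph_on1 X p : subgroup X -> morph_on X p -> p 1 = 1.
Proof.
by move=> [X1 _ _] pM; apply: (mulgI (p 1)); rewrite -pM // !mulg1.
Qed.

Lemma morph_onV X p h : subgroup X -> morph_on X p -> X h -> p h^-1 = (p h)^-1.
Proof.
move=> sX pM Xh; have [_ _ XV] := sX; apply: (mulgI (p h)).
by rewrite -pM ?mulgV ?(morph_on1 sX) //; exact: XV.
Qed.

Lemma fin_image_group_set p X :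
  subgroup X -> morph_on X p -> group_set (fin_image p X).
Proof.
move=> sX pM; have [X1 XM _] := sX; apply/group_setP; split.
  by apply/fin_imageP; exists 1; rewrite ?(morph_on1 sX).
move=> _ _ /fin_imageP[g Xg <-] /fin_imageP[h Xh <-].
by apply/fin_imageP; exists (g * h); [exact: XM|exact: pM].
Qed.

End FiniteImages.

(* If ker p <= ker q on X, the group q(X) is a quotient of p(X). *)
Lemma fin_image_nil d (gT rT : finGroupType) (X : set (tree_aut d))
    (p : tree_aut d -> gT) (q : tree_aut d -> rT) :
  subgroup X -> morph_on X p -> morph_on X q ->
  (forall h, X h -> p h = 1 -> q h = 1) ->
  nilpotent (fin_image p X) -> nilpotent (fin_image q X).
Proof.
move=> sX pM qM pq.
pose A := group (fin_image_group_set sX pM).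
pose B := group (fin_image_group_set sX qM).
have [X1 XM XV] := sX.
have eqpq g h : X g -> X h -> p g = p h -> q g = q h.
  move=> Xg Xh ghE; apply/eqP.
  rewrite eq_mulgV1 -(morph_onV sX qM) // -qM //; last exact: XV.
  apply/eqP/pq; first by apply: XM => //; exact: XV.
  by rewrite pM ?(morph_onV sX pM) ?ghE ?mulgV //; exact: XV.
(* On [A], [r] picks preimages under [p], so [q (r a)] is the induced homomorphism from p(X) to
   q(X). The value 1 off [A] is a dummy. *)
have /choice[r rP] a : exists h, a \in A -> X h /\ p h = a.
  case: (boolP (a \in A)) => [/fin_imageP[h Xh <-]|_]; last by exists 1.
  by exists h.
have rM : {in A &, {morph (fun a => q (r a)) : x y / x * y}}.
  move=> x y Ax Ay /=; have [Xx px] := rP _ Ax; have [Xy py] := rP _ Ay.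
  have [Xxy pxy] := rP _ (groupM Ax Ay).
  by rewrite -qM //; apply: eqpq => //; [exact: XM|rewrite pxy pM // px py].
move=> nA; have nfA : nilpotent (Morphism rM @* A) by apply: morphim_nil.
apply: nilpotentS nfA; apply/fintype.subsetP => _ /fin_imageP[h Xh <-].
have Aph : p h \in A by apply/fin_imageP; exists h.
have [Xr pr] := rP _ Aph.
by apply/morphimP; exists (p h) => //=; apply: eqpq.
Qed.

(** * The action on words of bounded length *)

Lemma size_aut d (g : tree_aut d) x : size (g x) = size x.
Proof.
have [t] := tree_iso_cat x (aut_iso g) (subtree_root [::]).
by case: (aut_iso g) => _ -> _ -> ->.
Qed.

Definition word_map d n (g : tree_aut d) (w : n.-bseq 'I_d) : n.-bseq 'I_d :=
  @Bseq n _ (g w) (eq_ind_r (leq^~ n) (size_bseq w) (size_aut g w)).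

Lemma word_map_inj d n (g : tree_aut d) : injective (@word_map d n g).
Proof.
move=> u v /(congr1 val)/= E; apply: val_inj => /=.
by rewrite -[LHS](aut_invK g) E aut_invK.
Qed.

(* Permutations compose from left to right and automorphisms from right to
   left, hence the inverse. *)
Definition level_act d n (g : tree_aut d) : {perm n.-bseq 'I_d} :=
  perm (@word_map_inj d n g^-1).

Lemma level_actM d n : {morph @level_act d n : g h / g * h}.
Proof.
move=> g h; apply/permP => w; rewrite permM !permE; apply: val_inj.
by rewrite -[LHS]/((g * h)^-1 (val w)) invgM.
Qed.

Lemma level_act_morph_on d n X : morph_on X (@level_act d n).
Proof. by move=> g h _ _; exact: level_actM. Qed.

Lemma level_act_eq1 d n (g : tree_aut d) :
  level_act n g = 1 <-> level_ball 1 n g.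
Proof.
split=> [/permP g1 x xn|g1].
  move: (g1 (Bseq xn)); rewrite permE perm1 => /(congr1 val)/= gx.
  by rewrite -{1}gx /= autK_inv.
apply/permP => w; rewrite permE perm1; apply: val_inj => /=.
have gw : g w = w := g1 _ (size_bseq w).
by rewrite -{1}gw; exact: aut_invK.
Qed.

Lemma level_ball1 d n (g h : tree_aut d) :
  level_ball g n h <-> level_ball 1 n (g^-1 * h).
Proof.
split=> gh x xn; first by move: (aut_invK g x); rewrite -gh.
by move: (autK_inv g (h x)) (gh _ xn) => <- /= ->.
Qed.

Lemma level_act_eq d n (g h : tree_aut d) :
  level_act n g = level_act n h <-> level_ball h n g.
Proof.
rewrite level_ball1 -level_act_eq1 level_actM.
have -> : level_act n h^-1 = (level_act n h)^-1.
  by apply: (@morph_onV _ _ setT); [|exact: level_act_morph_on|].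
split=> [->|/eqP]; first by rewrite mulVg.
by rewrite -eq_mulVg1 => /eqP.
Qed.

Definition level_image d n (X : set (tree_aut d)) := fin_image (@level_act d n) X.

Lemma level_image_group_set d n (X : set (tree_aut d)) :
  subgroup X -> group_set (level_image n X).
Proof. by move=> sX; apply: fin_image_group_set => // g h _ _; exact: level_actM. Qed.

(** * Level balls, open subgroups and limits *)

Lemma level_ball_sym d n (g h : tree_aut d) : level_ball g n h -> level_ball h n g.
Proof. by move=> gh x xn; rewrite gh. Qed.

Lemma level_ball_trans d n (f g h : tree_aut d) :
  level_ball f n g -> level_ball g n h -> level_ball f n h.
Proof. by move=> fg gh x xn; rewrite gh // fg. Qed.

Lemma nbhs_level_ball d n (g : tree_aut d) : nbhs g (level_ball g n).
Proof. by exists n. Qed.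

Lemma level_ball_open d n (g : tree_aut d) : open (level_ball g n).
Proof.
rewrite openE => h gh; exists n => k hk; exact: level_ball_trans gh hk.
Qed.

Lemma open_in_ball d (X U : set (tree_aut d)) g :
  open_in X U -> U g -> exists n, X `&` level_ball g n `<=` U.
Proof.
move=> [V Vo ->] [_ Vg]; have [n nV] : nbhs g V by apply: open_nbhs_nbhs.
by exists n => h [Xh /nV].
Qed.

(** An element of [G] in the [n]-ball around some [k] in [K] differs from [k] by an element of [G]
    in the [n]-ball of 1, hence lies in [K]. So the union of these balls cuts [K] out of [G]. *)
Lemma open_in_subgroup d (G K : set (tree_aut d)) n :
  subgroup K -> K `<=` G -> G `&` level_ball 1 n `<=` K ->
  subgroup G -> open_in G K.
Proof.
move=> [K1 KM KV] KG nK [_ GM GV].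
exists (\bigcup_(k in K) level_ball k n).
  by apply: bigcup_open => k _; exact: level_ball_open.
apply/seteqP; split=> [k Kk|g [Gg [k Kk /level_ball1 kg]]].
  by split; [exact: KG|exists k].
by rewrite -[g](mulKVg k); apply/KM/nK => //; split=> //; apply/GM/Gg/GV/KG.
Qed.

Lemma open_subgroup_closed d (G K : set (tree_aut d)) n :
  closed_subgroup G -> subgroup K -> K `<=` G ->
  G `&` level_ball 1 n `<=` K -> closed K.
Proof.
move=> [[_ GM GV] Gc] [K1 KM KV] KG nK g gK.
have Gg : G g by apply: Gc => B /gK[k [/KG Gk Bk]]; exists k.
have [k [Kk /level_ball_sym/level_ball1 kg]] := gK _ (nbhs_level_ball n g).
by rewrite -[g](mulKVg k); apply/KM/nK => //; split=> //; apply/GM/Gg/GV/KG.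
Qed.

(** Completeness of Aut T: the limit acts on a word [x] as [h_ (size x)]. Since lengths are
    preserved, bijectivity can be checked level by level. *)
Lemma aut_limit d (h_ : nat -> tree_aut d) :
  (forall m n, (m <= n)%N -> level_ball (h_ m) m (h_ n)) ->
  exists h, forall n, level_ball h n (h_ n).
Proof.
move=> hE; pose f (x : vertex d) := h_ (size x) x.
have fE n x : (size x <= n)%N -> f x = h_ n x by move=> xn; rewrite (hE _ _ xn).
have sf x : size (f x) = size x by exact: size_aut.
have fi : tree_iso [::] [::] f.
  split=> [||x y _ _]; last first.
  - set n := maxn (size x) (size y); rewrite !(fE n) ?leq_maxl ?leq_maxr //.
    by case: (aut_iso (h_ n)) => _ _; apply; exact: subtree_root.
  - by apply: size0nil; rewrite sf.
  split=> [x _|x y _ _ fxy|y _]; first exact: subtree_root.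
    have sxy : size x = size y by rewrite -sf fxy sf.
    move: fxy; rewrite !(fE (size y)) ?sxy // => xy.
    by rewrite -(aut_invK (h_ (size y)) x) xy aut_invK.
  exists (aut_inv (h_ (size y)) y); first exact: subtree_root.
  by rewrite /f size_aut; exact: autK_inv.
by exists (Defs.Aut fi) => n x xn; rewrite /= (fE n).
Qed.

(** * Pronilpotence in terms of level images *)

Lemma pronilpotent_level_nil d (X : set (tree_aut d)) n :
  subgroup X -> pronilpotent X -> nilpotent (level_image n X).
Proof.
move=> sX [S [p [pM _ _ _ pU]]]; have [X1 _ _] := sX.
(* The fibres of the [p i] form a basis of the topology, so the kernel of some [p i] on [X] lies in
   the ball. The level image is then a quotient of a subgroup of the nilpotent group [is_obj i]. *)
have [i iP] : exists i, forall h, X h -> p i h = p i 1 -> (X `&` level_ball 1 n) h.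
  by apply: pU; [exists (level_ball 1 n) => //; exact: level_ball_open|split].
apply: (fin_image_nil sX (pM i)) => [|h Xh ph|].
- exact: level_act_morph_on.
- by apply/level_act_eq1; apply: (iP h Xh _).2; rewrite ph (morph_on1 sX (pM i)).
- by apply: nilpotentS (is_nilpotent i); exact: finset.subsetT.
Qed.

Section LevelSystem.
Variables (d : nat) (X : set (tree_aut d)) (sX : subgroup X).
Hypothesis nX : forall n, nilpotent (level_image n X).

Let level_group n := group (level_image_group_set n sX).

Let proj n (h : tree_aut d) : subg_of (level_group n) :=
  subg (level_group n) (level_act n h).

Let in_level n h : X h -> level_act n h \in level_group n.
Proof. by move=> Xh; apply/fin_imageP; exists h. Qed.

Let proj_eq n g h : X g -> X h -> proj n g = proj n h <-> level_ball h n g.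
Proof.
move=> Xg Xh; rewrite -level_act_eq; split=> [/(congr1 val)|]; last first.
  by rewrite /proj => ->.
by rewrite !subgK //; exact: in_level.
Qed.

Let projM n : morph_on X (proj n).
Proof. by move=> g h Xg Xh; rewrite /proj level_actM subgM //; exact: in_level. Qed.

Let proj_onto n (x : subg_of (level_group n)) : exists h, X h /\ proj n h = x.
Proof.
have /fin_imageP[h Xh hx] := subgP x.
by exists h; split=> //; apply: val_inj; rewrite subgK //; exact: in_level.
Qed.

Let rep n (x : subg_of (level_group n)) : tree_aut d := sval (cid (proj_onto x)).

Let repX n x : X (@rep n x).
Proof. by rewrite /rep; case: cid => h []. Qed.

Let repK n x : proj n (@rep n x) = x.
Proof. by rewrite /rep; case: cid => h []. Qed.

(** Lift to [X], then project to level [m]. For [m <= n] the result does not depend on the lift,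
    which yields multiplicativity and compatibility. *)
Let trans m n (x : subg_of (level_group n)) : subg_of (level_group m) :=
  proj m (rep x).

Let trans_proj m n h : (m <= n)%N -> X h -> trans m (proj n h) = proj m h.
Proof.
move=> mn Xh; apply/(proj_eq _ (repX _) Xh).
have E : level_ball h n (rep (proj n h)).
  by apply/(proj_eq _ (repX _) Xh); exact: repK.
by move=> x xm; apply: E; exact: leq_trans mn.
Qed.

Let transM m n : (m <= n)%N -> {morph @trans m n : x y / x * y}.
Proof.
move=> mn x y; have [_ XM _] := sX.
rewrite -[in LHS](repK x) -[in LHS](repK y) -projM ?trans_proj //; last first.
  by apply: XM; exact: repX.
by rewrite projM //; exact: repX.
Qed.

Let trans_comp i j k : (i <= j)%N -> (j <= k)%N ->
  forall x, trans i (@trans j k x) = trans i x.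
Proof. by move=> ij jk x; rewrite [trans j x]/trans trans_proj //; exact: repX. Qed.

Let level_nil n : nilpotent [set: subg_of (level_group n)]%SET.
Proof. by rewrite -(isog_nil (isog_subg (level_group n))); exact: nX. Qed.

(** The identity law is [repK] itself, as [trans n n x] unfolds to [proj n (rep x)]. *)
Definition level_system : nil_inverse_system :=
  @NilInverseSystem nat leq leqnn (fun i j k => @leq_trans j i k)
    (ex_intro (fun=> True) 0%N I)
    (fun i j => ex_intro2 (leq i) (leq j) _ (leq_maxl i j) (leq_maxr i j))
    (fun n => subg_of (level_group n)) level_nil trans transM repK trans_comp.

Lemma level_nil_pronilpotent : closed X -> pronilpotent X.
Proof.
move=> Xc; exists level_system, proj; split=> /=.
- exact: projM.
- by move=> i j g ij Xg; exact: trans_proj.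
(* Lifts of a compatible family agree on ever more levels, so they converge in Aut T; closedness
   puts the limit in [X]. *)
- move=> x xE; have [h hP] : exists h, forall n, level_ball h n (rep (x n)).
    apply: aut_limit => m n mn; apply/(proj_eq _ (repX _) (repX _)).
    by rewrite repK -(xE _ _ mn).
  have Xh : X h.
    by apply: Xc => B [n nB]; exists (rep (x n)); split; [exact: repX|exact/nB].
  exists h; split=> [|g [Xg gx]].
    split=> // n; rewrite -(repK (x n)); apply/(proj_eq _ Xh (repX _)).
    exact/level_ball_sym.
  apply: aut_ext => y; have yy := leqnn (size y).
  rewrite -(hP _ _ yy); apply: ((proj_eq _ (repX _) Xg).1 _ _ yy).
  by rewrite repK gx.
- move=> n x; exists (level_ball (rep x) n); first exact: level_ball_open.
  apply/seteqP; split=> h [Xh hx]; split=> //.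
    by apply/(proj_eq _ Xh (repX _)); rewrite repK.
  by rewrite -[RHS]repK; apply/(proj_eq _ Xh (repX _)).
- move=> U g oU Ug; have [n nU] := open_in_ball oU Ug.
  have Xg : X g by case: oU Ug => V _ -> [].
  by exists n => h Xh /(proj_eq _ Xh Xg) hg; apply: nU.
Qed.

End LevelSystem.

(** * Products of normal subgroups *)

Definition mul_set d (X Y : set (tree_aut d)) : set (tree_aut d) :=
  [set g * h | g in X & h in Y].

Lemma mul_set_normal d (G X Y : set (tree_aut d)) :
  normal_in G X -> normal_in G Y -> subgroup G -> normal_in G (mul_set X Y).
Proof.
move=> [[X1 XM XV] XG XJ] [[Y1 YM YV] YG YJ] [_ GM GV]; split.
- split; first by exists 1 => //; exists 1; rewrite ?mulg1.
    move=> _ _ [x Xx [y Yy <-]] [x' Xx' [y' Yy' <-]].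
    exists (x * x'); first exact: XM.
    (* From x y x' y' = (x x') (y^x' y'). *)
    exists (y ^ x' * y'); first by apply: YM => //; apply: YJ => //; exact: XG.
    by rewrite /conjg !mulgA mulgK.
  move=> _ [x Xx [y Yy <-]]; exists x^-1; first exact: XV.
  exists (y^-1 ^ x^-1); first by apply: YJ; [exact/XG/XV|exact: YV].
  by rewrite /conjg invgK invgM !mulgA mulVg mul1g.
- by move=> _ [x Xx [y Yy <-]]; apply: GM; [exact: XG|exact: YG].
- move=> g _ Gg [x Xx [y Yy <-]]; exists (x ^ g); first exact: XJ.
  by exists (y ^ g); [exact: YJ|rewrite conjMg].
Qed.

Lemma level_image_normal d n (G X : set (tree_aut d)) (sG : subgroup G) (sX : subgroup X) :
  normal_in G X ->
  group (level_image_group_set n sX) <| group (level_image_group_set n sG).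
Proof.
move=> [_ XG XJ]; apply/andP; split; first exact: fin_imageS.
apply/normsP => _ /fin_imageP[g Gg <-].
apply/eqP; rewrite eqEcard cardJg leqnn andbT.
apply/fintype.subsetP => _ /imsetP[_ /fin_imageP[x Xx <-] ->].
apply/fin_imageP; exists (x ^ g); first exact: XJ.
rewrite /conjg !level_actM (@morph_onV _ _ setT) //; exact: level_act_morph_on.
Qed.

(* Fitting's theorem in the image of G. *)
Lemma level_image_mul_nil d n (G X Y : set (tree_aut d)) :
  subgroup G -> normal_in G X -> normal_in G Y ->
  nilpotent (level_image n X) -> nilpotent (level_image n Y) ->
  nilpotent (level_image n (mul_set X Y)).
Proof.
move=> sG nX nY; have [sX _ _] := nX; have [sY _ _] := nY.
move=> /(Fitting_max (level_image_normal n sG sX nX)) /fintype.subsetP XF.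
move=> /(Fitting_max (level_image_normal n sG sY nY)) /fintype.subsetP YF.
apply: nilpotentS (Fitting_nil (group (level_image_group_set n sG))).
apply/fintype.subsetP => _ /fin_imageP[_ [x Xx [y Yy <-]] <-].
rewrite level_actM groupM //; [apply: XF|apply: YF]; apply/fin_imageP.
  by exists x.
by exists y.
Qed.

(** * Sections at a vertex *)

Section VertexSections.
Variables (d : nat) (P : path_data d) (v : vertex d).

Lemma vproj_fun (h g g' : tree_aut d) : vproj P v h g -> vproj P v h g' -> g = g'.
Proof.
move=> hg hg'; apply: aut_ext => y.
have [[_ _ vmap_onto] _ _] := vmap_iso P v.
by have [x vx <-] := vmap_onto _ (subtree_root y); rewrite hg // hg'.
Qed.

Lemma subtree_stab (h : tree_aut d) x : h v = v -> subtree v x -> subtree v (h x).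
Proof.
move=> hv; have := tree_iso_sub (aut_iso h) (subtree_root v); rewrite hv.
by move=> [[hS _ _] _ _]; exact: hS.
Qed.

Lemma stabV (h : tree_aut d) : h v = v -> h^-1 v = v.
Proof. by move=> hv; move: (aut_invK h v); rewrite hv. Qed.

Lemma vprojM (h h' g g' : tree_aut d) : h' v = v ->
  vproj P v h g -> vproj P v h' g' -> vproj P v (h * h') (g * g').
Proof. by move=> h'v hg hg' x vx; rewrite /= hg' // hg //; exact: subtree_stab. Qed.

Lemma vprojV (h g : tree_aut d) : h v = v -> vproj P v h g -> vproj P v h^-1 g^-1.
Proof.
move=> hv hg x vx; rewrite -(aut_invK g (vmap P v (h^-1 x))).
by rewrite hg ?[h _]autK_inv //; apply: subtree_stab vx; exact: stabV.
Qed.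

Lemma vproj1 : vproj P v 1 1. Proof. by []. Qed.

Lemma stabilizer_subgroup X : subgroup X -> subgroup (stabilizer X v).
Proof.
move=> [X1 XM XV]; split=> [//|g h [Xg gv] [Xh hv]|g [Xg gv]].
  by split; [exact: XM|rewrite /= hv].
by split; [exact: XV|exact: stabV].
Qed.

Lemma vsectionS (X Y : set (tree_aut d)) :
  X `<=` Y -> vsection P X v `<=` vsection P Y v.
Proof. by move=> XY g [h [/XY Yh hv] hg]; exists h. Qed.

(** Because G^v = G, each [g] in [G] is the section of some [k] in [G] fixing [v]. Conjugating by
    [k] preserves [X] and the stabilizer of [v], and induces conjugation by [g] on sections. *)
Lemma vsection_normal G X : vsection P G v = G -> subgroup X ->
  normal_in G X -> normal_in G (vsection P X v).
Proof.
move=> Gv [X1 XM XV] [_ XG XJ]; split.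
- split; first by exists 1 => //; exact: vproj1.
    move=> g g' [h [Xh hv] hg] [h' [Xh' h'v] hg'].
    by exists (h * h'); [split; [exact: XM|rewrite /= h'v]|exact: vprojM].
  move=> g [h [Xh hv] hg].
  by exists h^-1; [split; [exact: XV|exact: stabV]|exact: vprojV].
- by rewrite -[X in _ `<=` X]Gv; exact: vsectionS.
- move=> g x; rewrite -{1}Gv => -[k [Gk kv] kg] [h [Xh hv] hx].
  exists (h ^ k); first by split; [exact: XJ|rewrite /= kv hv [LHS]stabV].
  apply: vprojM; [by rewrite /= kv hv|exact: vprojV|exact: vprojM].
Qed.

Lemma size_vmap x : subtree v x -> size x = (size v + size (vmap P v x))%N.
Proof.
case/prefixP => s ->.
have [t -> ts] := tree_iso_cat s (vmap_iso P v) (prefix_refl v).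
by have [_ -> _] := vmap_iso P v; rewrite /= ts; exact: size_cat.
Qed.

(** Since [vmap P v] lowers levels by [size v], an element fixing [v] that is trivial up to level
    [size v + n] has a section trivial up to level [n]. So the level image of the sections is a
    quotient of that of the stabilizer. *)
Lemma vsection_nil n X : subgroup X ->
  nilpotent (level_image (size v + n) X) -> nilpotent (level_image n (vsection P X v)).
Proof.
move=> sX nX; have sXv := stabilizer_subgroup sX.
(* [s] makes the section a total function, with dummy value 1 where [v] is moved. *)
have /choice[s sP] (h : tree_aut d) : exists g, h v = v -> vproj P v h g.
  case: (pselect (h v = v)) => [hv|nhv]; last by exists 1.
  by have [g [hg _]] := vproj_ex P hv; exists g.
have sE (h g : tree_aut d) : h v = v -> vproj P v h g -> s h = g.
  by move=> hv hg; apply: vproj_fun hg; exact: sP.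
have nXv : nilpotent (level_image (size v + n) (stabilizer X v)).
  by apply: nilpotentS nX; apply: fin_imageS => h [].
have -> : level_image n (vsection P X v) =
    fin_image (fun h => level_act n (s h)) (stabilizer X v).
  apply/setP => y; apply/fin_imageP/fin_imageP => [[g [h Xh hg] <-]|[h Xh <-]].
    by exists h => //; rewrite (sE _ g) //; case: Xh.
  by exists (s h) => //; exists h => //; apply: sP; case: Xh.
apply: fin_image_nil nXv => //; first exact: level_act_morph_on.
  move=> h h' [_ hv] [_ h'v]; rewrite (sE _ (s h * s h')) ?level_actM //=.
    by rewrite h'v.
  by apply: vprojM => //; exact: sP.
move=> h [_ hv] /level_act_eq1 h1; apply/level_act_eq1 => y yn.
have [[_ _ vmap_onto] _ _] := vmap_iso P v.
have [x vx xy] := vmap_onto _ (subtree_root y); rewrite -xy (sP _ hv) //.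
by rewrite h1 // size_vmap // xy leq_add2l.
Qed.

End VertexSections.

Theorem proposition27 (d : nat) (d_gt0 : (0 < d)%N) (P : path_data d)
    (G : set (tree_aut d)) (HG : fractal P G)
    (H : set (tree_aut d)) (HH : open_normal_pronilpotent G H) :
  open_normal_pronilpotent G (self_similar_closure P G H).
Proof.
have [Gcs Gv] := HG; have [sG Gc] := Gcs; have [oH nH pH] := HH.
have [sH HsubG _] := nH.
(* From level [m] on, [H] contains everything in [G] acting trivially, so a subgroup between [H] and
   [G] is determined by its image at level [m]. *)
have [m mH] := open_in_ball oH (let: And3 H1 _ _ := sH in H1).
set S := self_similar_closure P G H.
have [sS HS SG Smin] : let K := S in [/\ self_similar P K, H `<=` K, K `<=` G
    & forall L, self_similar P L -> L `<=` G -> H `<=` L -> K `<=` L].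
  by apply: self_similar_closureP => //; split=> // v; rewrite Gv.
have [[[_ SM _] _] Sv] := sS.
pose good (K : set (tree_aut d)) := [/\ normal_in G K, H `<=` K, K `<=` S
  & forall n, nilpotent (level_image n K)].
have goodH : good H by split=> // n; exact: pronilpotent_level_nil.
(* Maximality is taken among the finitely many images at level [m], and then transferred to
   subgroups in [maxK]. *)
pose goodb (A : {set {perm m.-bseq 'I_d}}) :=
  `[< exists2 K, good K & level_image m K = A >].
have [A /maxsetP[/asboolP[K gK KA] maxA] _] : {A | maxset goodb A &
    level_image m H \subset A}.
  by apply: maxset_exists; apply/asboolP; exists H.
have [nK HK KS KN] := gK; have [sK KG _] := nK.
have mK : G `&` level_ball 1 m `<=` K by apply: subset_trans HK.
have maxK L : good L -> K `<=` L -> L `<=` K.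
  move=> gL KL g Lg; have [[sL LG _] _ _ _] := gL.
  have LA : level_image m L = A.
    by apply: maxA; [apply/asboolP; exists L|rewrite -KA; exact: fin_imageS].
  have : level_act m g \in level_image m K.
    by rewrite KA -LA; apply/fin_imageP; exists g.
  (* [g] and [k] act alike up to level [m], so k^-1 g lies in [G] and in the [m]-ball of 1, hence in
     [K]. *)
  case/fin_imageP => k Kk /esym/level_act_eq/level_ball1 kg.
  have [_ GM GV] := sG; have [_ KM _] := sK.
  rewrite -[g](mulKVg k); apply: KM => //; apply: mK; split=> //.
  by apply: GM; [exact/GV/KG|exact: LG].
have Kv v : vsection P K v `<=` K.
  have nKv := vsection_normal (Gv v) sK nK; have [sKv _ _] := nKv.
  have [K1 _ _] := sK; have [Kv1 _ _] := sKv.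
  have KL : K `<=` mul_set K (vsection P K v).
    by move=> k Kk; exists k => //; exists 1; rewrite ?mulg1.
  (* K K^v is good: it stays in [S] by self-similarity of [S], and its level images are nilpotent by
     Fitting. Maximality absorbs it into [K]. *)
  apply: subset_trans (maxK (mul_set K (vsection P K v)) _ KL).
    by move=> k Kk; exists 1 => //; exists k; rewrite ?mul1g.
  split; [exact: mul_set_normal|exact: subset_trans KL| |].
    move=> _ [k Kk [l Kvl <-]]; apply: SM; first exact: KS.
    by apply: (Sv v); apply: vsectionS Kvl.
  move=> n; apply: (level_image_mul_nil sG nK nKv) => //; exact: vsection_nil.
have Kc : closed K by exact: open_subgroup_closed mK.
(* [K] is closed and contains its sections, so minimality of the closure gives the remaining
   inclusion. *)
have -> : S = K by apply/seteqP; split=> //; apply: Smin.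
split=> //; first exact: open_in_subgroup mK sG.
exact: level_nil_pronilpotent.
Qed.
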